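(* Let $n\geq 0$ be an integer. Then $$\mathbf{Q}W_{n+2}(s)=(\alpha^{s}+\beta^{s})\,\mathbf{Q}W_{n+1}(s)-(\alpha\beta)^{s}\,\mathbf{Q}W_{n}(s),$$ where $\mathbf{Q}W_{n}(s)$ is the $n$th higher order Horadam 3-parameter generalized quaternion.
   Context: Let $\alpha,\beta$ be distinct nonzero real numbers, $W_0,W_1$ real numbers, $A=W_1-W_0\beta$, $B=W_1-W_0\alpha$, and let $W_n=\frac{A\alpha^n-B\beta^n}{\alpha-\beta}$ ($n\geq 0$) be the Horadam numbers. Fix an integer $s\geq 1$ with $W_s\neq 0$, equivalently $A\alpha^s-B\beta^s\neq 0$. The higher order Horadam numbers are $W_n(s)=\frac{W_{sn}}{W_s}=\frac{A\alpha^{sn}-B\beta^{sn}}{A\alpha^s-B\beta^s}$, $n\geq 0$. Let $\lambda_1,\lambda_2,\lambda_3$ be real parameters. The 3-parameter generalized quaternions form the real algebra of elements $x_0\mathbf{1}+x_1\mathbf{i}+x_2\mathbf{j}+x_3\mathbf{k}$ ($x_r\in\mathbb{R}$) with basis $\mathbf{1},\mathbf{i},\mathbf{j},\mathbf{k}$ and bilinear multiplication in which $\mathbf{1}$ is the identity and $\mathbf{i}^2=-\lambda_1\lambda_2\mathbf{1}$, $\mathbf{j}^2=-\lambda_1\lambda_3\mathbf{1}$, $\mathbf{k}^2=-\lambda_2\lambda_3\mathbf{1}$, $\mathbf{i}\mathbf{j}=\lambda_1\mathbf{k}=-\mathbf{j}\mathbf{i}$, $\mathbf{j}\mathbf{k}=\lambda_3\mathbf{i}=-\mathbf{k}\mathbf{j}$,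 $\mathbf{k}\mathbf{i}=\lambda_2\mathbf{j}=-\mathbf{i}\mathbf{k}$. The higher order Horadam 3-parameter generalized quaternions are $\mathbf{Q}W_n(s)=W_n(s)\mathbf{1}+W_{n+1}(s)\mathbf{i}+W_{n+2}(s)\mathbf{j}+W_{n+3}(s)\mathbf{k}$, $n\geq 0$. *)

(* Defs.v *)
From HB Require Import structures.
From mathcomp Require Import all_boot all_order all_algebra ring.
From mathcomp Require Import reals.

Set Implicit Arguments.
Unset Strict Implicit.
Unset Printing Implicit Defensive.

Import Order.TTheory GRing.Theory Num.Theory.
Local Open Scope ring_scope.

(* The element [GQuat l1 l2 l3 x0 x1 x2 x3] is x0 1 + x1 i + x2 j + x3 k.  The
   parameters occur in no field: they only select the multiplication. *)
Record gquat (R : realType) (l1 l2 l3 : R) : Type :=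
  GQuat { gq0 : R; gq1 : R; gq2 : R; gq3 : R }.

Section GQuatAlgebra.
Variables (R : realType) (l1 l2 l3 : R).
Local Notation Q := (gquat l1 l2 l3).
Implicit Types (x y z : Q) (a b : R).

Definition gq_code x : R * R * R * R := (gq0 x, gq1 x, gq2 x, gq3 x).
Definition gq_decode (t : R * R * R * R) : Q :=
  GQuat l1 l2 l3 t.1.1.1 t.1.1.2 t.1.2 t.2.

Lemma gq_codeK : cancel gq_code gq_decode.
Proof. by case. Qed.

HB.instance Definition _ := Choice.copy Q (can_type gq_codeK).

Lemma gquatP x y : gq0 x = gq0 y -> gq1 x = gq1 y -> gq2 x = gq2 y ->
  gq3 x = gq3 y -> x = y.
Proof. by case: x => ????; case: y => ???? /= -> -> -> ->. Qed.

Definition gq_zero : Q := GQuat l1 l2 l3 0 0 0 0.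
Definition gq_opp x : Q :=
  GQuat l1 l2 l3 (- gq0 x) (- gq1 x) (- gq2 x) (- gq3 x).
Definition gq_add x y : Q :=
  GQuat l1 l2 l3 (gq0 x + gq0 y) (gq1 x + gq1 y) (gq2 x + gq2 y)
                 (gq3 x + gq3 y).
Definition gq_scale a x : Q :=
  GQuat l1 l2 l3 (a * gq0 x) (a * gq1 x) (a * gq2 x) (a * gq3 x).

Fact gq_addA : associative gq_add.
Proof. by move=> x y z; apply: gquatP; rewrite /= addrA. Qed.
Fact gq_addC : commutative gq_add.
Proof. by move=> x y; apply: gquatP; rewrite /= addrC. Qed.
Fact gq_add0 : left_id gq_zero gq_add.
Proof. by move=> x; apply: gquatP; rewrite /= add0r. Qed.
Fact gq_addN : left_inverse gq_zero gq_opp gq_add.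
Proof. by move=> x; apply: gquatP; rewrite /= addNr. Qed.

HB.instance Definition _ :=
  GRing.isZmodule.Build Q gq_addA gq_addC gq_add0 gq_addN.

Definition gq_one : Q := GQuat l1 l2 l3 1 0 0 0.

(* Bilinear extension of the multiplication table of 1, i, j, k, which is
   recovered in [gq_ii], ..., [gq_ik] below. *)
Definition gq_mul x y : Q :=
  let: GQuat x0 x1 x2 x3 := x in let: GQuat y0 y1 y2 y3 := y in
  GQuat l1 l2 l3
    (x0 * y0 - l1 * l2 * (x1 * y1) - l1 * l3 * (x2 * y2) - l2 * l3 * (x3 * y3))
    (x0 * y1 + x1 * y0 + l3 * (x2 * y3 - x3 * y2))
    (x0 * y2 + x2 * y0 + l2 * (x3 * y1 - x1 * y3))
    (x0 * y3 + x3 * y0 + l1 * (x1 * y2 - x2 * y1)).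

Fact gq_mulA : associative gq_mul.
Proof. by do 3![case=> ????]; apply: gquatP => /=; ring. Qed.
Fact gq_mul1 : left_id gq_one gq_mul.
Proof. by case=> ????; apply: gquatP => /=; ring. Qed.
Fact gq_1mul : right_id gq_one gq_mul.
Proof. by case=> ????; apply: gquatP => /=; ring. Qed.
Fact gq_mulDl : left_distributive gq_mul +%R.
Proof. by do 3![case=> ????]; apply: gquatP => /=; ring. Qed.
Fact gq_mulDr : right_distributive gq_mul +%R.
Proof. by do 3![case=> ????]; apply: gquatP => /=; ring. Qed.
Fact gq_one_neq0 : gq_one != 0.
Proof. by apply/eqP => -[] /eqP; rewrite oner_eq0. Qed.

HB.instance Definition _ := GRing.Zmodule_isNzRing.Build Q
  gq_mulA gq_mul1 gq_1mul gq_mulDl gq_mulDr gq_one_neq0.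

Fact gq_scaleA a b x : gq_scale a (gq_scale b x) = gq_scale (a * b) x.
Proof. by apply: gquatP; rewrite /= mulrA. Qed.
Fact gq_scale1 : left_id 1 gq_scale.
Proof. by move=> x; apply: gquatP; rewrite /= mul1r. Qed.
Fact gq_scaleDr : right_distributive gq_scale +%R.
Proof. by move=> a x y; apply: gquatP; rewrite /= mulrDr. Qed.
Fact gq_scaleDl x : {morph gq_scale^~ x : a b / a + b}.
Proof. by move=> a b; apply: gquatP; rewrite /= mulrDl. Qed.

HB.instance Definition _ := GRing.Zmodule_isLmodule.Build R Q
  gq_scaleA gq_scale1 gq_scaleDr gq_scaleDl.

Fact gq_scaleAl a x y : a *: (x * y) = (a *: x) * y.
Proof. by case: x y => ???? [????]; apply: gquatP => /=; ring. Qed.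

HB.instance Definition _ := GRing.Lmodule_isLalgebra.Build R Q gq_scaleAl.

Fact gq_scaleAr a x y : a *: (x * y) = x * (a *: y).
Proof. by case: x y => ???? [????]; apply: gquatP => /=; ring. Qed.

HB.instance Definition _ := GRing.Lalgebra_isAlgebra.Build R Q gq_scaleAr.

Definition gq_i : Q := GQuat l1 l2 l3 0 1 0 0.
Definition gq_j : Q := GQuat l1 l2 l3 0 0 1 0.
Definition gq_k : Q := GQuat l1 l2 l3 0 0 0 1.

Lemma gquatE x :
  x = gq0 x *: 1 + gq1 x *: gq_i + gq2 x *: gq_j + gq3 x *: gq_k.
Proof. by apply: gquatP => /=; ring. Qed.

Lemma gq_ii : gq_i * gq_i = - (l1 * l2) *: 1.
Proof. by apply: gquatP => /=; ring. Qed.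
Lemma gq_jj : gq_j * gq_j = - (l1 * l3) *: 1.
Proof. by apply: gquatP => /=; ring. Qed.
Lemma gq_kk : gq_k * gq_k = - (l2 * l3) *: 1.
Proof. by apply: gquatP => /=; ring. Qed.
Lemma gq_ij : gq_i * gq_j = l1 *: gq_k.
Proof. by apply: gquatP => /=; ring. Qed.
Lemma gq_ji : gq_j * gq_i = - (l1 *: gq_k).
Proof. by apply: gquatP => /=; ring. Qed.
Lemma gq_jk : gq_j * gq_k = l3 *: gq_i.
Proof. by apply: gquatP => /=; ring. Qed.
Lemma gq_kj : gq_k * gq_j = - (l3 *: gq_i).
Proof. by apply: gquatP => /=; ring. Qed.
Lemma gq_ki : gq_k * gq_i = l2 *: gq_j.
Proof. by apply: gquatP => /=; ring. Qed.
Lemma gq_ik : gq_i * gq_k = - (l2 *: gq_j).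
Proof. by apply: gquatP => /=; ring. Qed.

End GQuatAlgebra.

Arguments gq_i {R l1 l2 l3}.
Arguments gq_j {R l1 l2 l3}.
Arguments gq_k {R l1 l2 l3}.

Section Horadam.
Variables (R : realType) (alpha beta W0 W1 : R).

Definition horadam (n : nat) : R :=
  let A := W1 - W0 * beta in
  let B := W1 - W0 * alpha in
  (A * alpha ^+ n - B * beta ^+ n) / (alpha - beta).

Definition ho_horadam (s n : nat) : R := horadam (s * n) / horadam s.

Definition ho_horadam_gquat (l1 l2 l3 : R) (s n : nat) : gquat l1 l2 l3 :=
  ho_horadam s n *: 1 + ho_horadam s n.+1 *: gq_i +
  ho_horadam s n.+2 *: gq_j + ho_horadam s n.+3 *: gq_k.

Lemma ho_horadamE (s n : nat) : alpha != beta ->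
  ho_horadam s n =
    ((W1 - W0 * beta) * alpha ^+ (s * n) - (W1 - W0 * alpha) * beta ^+ (s * n))
  / ((W1 - W0 * beta) * alpha ^+ s - (W1 - W0 * alpha) * beta ^+ s).
Proof.
move=> ab; rewrite /ho_horadam /horadam invfM invrK mulrACA mulVf ?mulr1 //.
by rewrite subr_eq0.
Qed.

End Horadam.

(* Main.v *)
Require Import Defs.
From mathcomp Require Import all_boot all_order all_algebra ring.
From mathcomp Require Import reals.

Import Order.TTheory GRing.Theory Num.Theory.
Local Open Scope ring_scope.

(** Up to a constant factor, [ho_horadam] at [n] is a combination of the [n]th powers of
    [alpha ^+ s] and [beta ^+ s], the roots of X^2 - (alpha^s + beta^s) X + (alpha beta)^s. This
    gives the scalar recurrence, which passes to each quaternion coordinate. *)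

Lemma ho_horadam_rec (R : realType) (alpha beta W0 W1 : R) (s n : nat) :
  ho_horadam alpha beta W0 W1 s n.+2 =
    (alpha ^+ s + beta ^+ s) * ho_horadam alpha beta W0 W1 s n.+1
    - (alpha * beta) ^+ s * ho_horadam alpha beta W0 W1 s n.
Proof.
rewrite /ho_horadam {1 3 5}/horadam !mulnS !exprD exprMn.
(* With both inverses as variables, the goal is a polynomial identity. *)
by move: (alpha - beta)^-1 (horadam _ _ _ _ _)^-1 => d w; ring.
Qed.

Theorem theorem2p1 (R : realType) (alpha beta W0 W1 : R) (l1 l2 l3 : R)
  (s : nat) (n : nat)
  (alpha_neq0 : alpha != 0) (beta_neq0 : beta != 0)
  (alpha_neq_beta : alpha != beta)
  (s_ge1 : (1 <= s)%N) (Ws_neq0 : horadam alpha beta W0 W1 s != 0) :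
  let QW : nat -> gquat l1 l2 l3 :=
    ho_horadam_gquat alpha beta W0 W1 l1 l2 l3 s in
  QW n.+2 = (alpha ^+ s + beta ^+ s) *: QW n.+1 - (alpha * beta) ^+ s *: QW n.
Proof.
have rec := @ho_horadam_rec R alpha beta W0 W1 s.
rewrite /ho_horadam_gquat /=.
(* Descending indices reduce every term to the values at [n] and [n.+1]. *)
by apply: gquatP; rewrite /= (rec n.+3) (rec n.+2) (rec n.+1) (rec n); ring.
Qed.
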